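(* Let $N\ge1$, let $\rho_1>\sigma_1>\rho_2>\sigma_2>\dots>\rho_N>\sigma_N>0$, and let $u$ be the rational function in $L^2_+(\mathbb T)$ corresponding to this finite list of singular values and to the angles $\psi_r=0$, $r=1,\dots,2N$. Then $$\|u\|_{C^1}\ge\sum_{k=1}^N\frac{\sigma_k(\rho_k+\sigma_k)}{\rho_k-\sigma_k}.$$
   Context: The function $u$ is given by $$u(z)=\langle\mathscr C_N(z)^{-1}(\mathbf 1_N),\mathbf 1_N\rangle,\qquad \mathscr C_N(z)=\left(\frac{\rho_j-\sigma_kz}{\rho_j^2-\sigma_k^2}\right)_{1\le j,k\le N},\qquad \mathbf 1_N=(1,\dots,1)^T\in\mathbb C^N,$$ with Taylor expansion $u(z)=\sum_{n\ge0}\hat u(n)z^n$; elements of $L^2_+(\mathbb T)$ (functions on $\mathbb T=\mathbb R/2\pi\mathbb Z$ in $L^2$ with only nonnegative Fourier modes) are identified with holomorphic functions on the unit disc. The $\rho_j$ and $\sigma_k$ are the nonzero singular values of the Hankel matrices $(\hat u(n+p))_{n,p\ge0}$ and $(\hat u(n+p+1))_{n,p\ge0}$ respectively. It is known that these Hankel matrices are positive operators on $\ell^2(\mathbb Z_+)$, so that $\hat u(n)\ge0$ for all $n$. The $C^1$ norm of $u$ on $\mathbb T$ is taken to be $\|u\|_{C^1}=\sup_{x\in\mathbb T}\left|\frac{d}{dx}u(e^{ix})\right|$, which here equals $\sum_{n\ge1}n\,\hat u(n)$. *)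

(* Defs.v *)
From mathcomp Require Export all_boot all_order all_algebra.
From mathcomp Require Export complex.
From mathcomp Require Export all_classical all_reals all_analysis.
Export numFieldNormedType.Exports.
Export Order.TTheory GRing.Theory Num.Theory.

Set Implicit Arguments.
Unset Strict Implicit.
Unset Printing Implicit Defensive.

Local Open Scope classical_set_scope.
Local Open Scope ring_scope.
Local Open Scope complex_scope.

Definition expi (R : realType) (x : R) : R[i] := cos x +i* sin x.

Definition hdot (R : realType) (N : nat) (v w : 'cV[R[i]]_N) : R[i] :=
  \sum_(k < N) v k 0 * (w k 0)^*.

Definition ones (R : realType) (N : nat) : 'cV[R[i]]_N := const_mx 1.

Definition CN (R : realType) (N : nat) (rho sigma : 'I_N -> R) (z : R[i])
  : 'M[R[i]]_N :=
  \matrix_(j < N, k < N)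
    (((rho j)%:C - (sigma k)%:C * z) / ((rho j)^+2 - (sigma k)^+2)%:C).

(* For rho_1 > sigma_1 > ... > rho_N > sigma_N > 0 the matrix CN z is
   invertible for every |z| <= 1, so [invmx] is the genuine inverse there. *)
Definition u_sym (R : realType) (N : nat) (rho sigma : 'I_N -> R) (z : R[i])
  : R[i] :=
  hdot (invmx (CN rho sigma z) *m ones R N) (ones R N).

(* The derivative of a function of a real variable with values in C = R^2,
   taken componentwise. *)
Definition derivC (R : realType) (g : R -> R[i]) (x : R) : R[i] :=
  @Complex R (derive1 (fun t => complex.Re (g t)) x)
             (derive1 (fun t => complex.Im (g t)) x).

(* sup_x |d/dx f(e^{ix})|, as an extended real; x ranges over R, which by
   2pi-periodicity is the same as ranging over the circle R/2piZ. *)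
Definition C1norm (R : realType) (f : R[i] -> R[i]) : \bar R :=
  ereal_sup [set (Normc.normc (derivC (fun t => f (expi t)) x))%:E
            | x in [set: R]].

(* Main.v *)
(** At [z = 1] the matrix C_N(z) is the Cauchy matrix K = (1/(rho_j + sigma_k)),
    and C_N(z) = K - (z - 1) B with B = (sigma_k / (rho_j^2 - sigma_k^2)).
    Since |d/dx u(e^{ix})| at x = 0 is at least u'(1) = 1^T K^-1 B K^-1 1, it
    suffices to bound the latter.  The Cauchy systems K x = 1 and y^T K = 1^T are
    solved by comparing monic polynomials of degree N with prescribed roots, which
    gives u'(1) as a sum over k of
    sigma_k (rho_k + sigma_k) / (rho_k - sigma_k) times the product over l <> k of
    (sigma_k + sigma_l)(sigma_k + rho_l) / ((rho_l - sigma_k)(sigma_l - sigma_k)).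
    By interlacing both factors of the last denominator have the same sign, so each
    quotient is at least 1. *)
Require Import Defs.
From mathcomp Require Import ring lra.

Set Implicit Arguments.
Unset Strict Implicit.
Unset Printing Implicit Defensive.

Local Open Scope ring_scope.

(** * Cauchy linear systems solved through polynomial identities *)

Lemma horner_prod_XsubC (F : fieldType) (I : finType) (P : pred I) (f : I -> F) t :
  (\prod_(i | P i) ('X - (f i)%:P)).[t] = \prod_(i | P i) (t - f i).
Proof. by rewrite horner_prod; apply: eq_bigr => i _; rewrite hornerXsubC. Qed.

Section CauchySystems.
Variables (F : fieldType) (N : nat) (a p : 'I_N -> F).
Hypotheses (a_inj : injective a) (p_inj : injective p).
Hypothesis (a_neq_p : forall j k, a j - p k != 0).
Implicit Type x : 'I_N -> F.

(* The numerator of [\sum_k x k / ('X - p k)] over the common denominator. *)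
Definition cauchy_numer x : {poly F} :=
  \sum_(k < N) x k *: \prod_(l < N | l != k) ('X - (p l)%:P).

(** Each summand omits one of the [N] monic linear factors, hence has degree [N - 1]. *)
Lemma size_cauchy_numer x : (size (cauchy_numer x) <= N)%N.
Proof.
apply: (leq_trans (size_sum _ _ _)); apply/bigmax_leqP => k _.
apply: (leq_trans (size_scale_leq _ _)).
have := size_prod_XsubC (index_enum 'I_N) p.
rewrite -[index_enum _]enumT -cardE card_ord enumT (bigD1 k) //= mulrC.
rewrite size_Mmonic ?monicXsubC ?size_XsubC //; first by rewrite addn2 => -[->].
by apply/monic_neq0/monic_prod_XsubC.
Qed.

Lemma horner_cauchy_numer_pole x k :
  (cauchy_numer x).[p k] = x k * \prod_(l < N | l != k) (p k - p l).
Proof.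
rewrite horner_sum (bigD1 k) //= [X in _ + X]big1 ?addr0 => [|i ik].
  by rewrite hornerZ horner_prod_XsubC.
rewrite hornerZ horner_prod_XsubC (bigD1 k) 1?eq_sym //=.
by rewrite subrr mul0r mulr0.
Qed.

Lemma horner_cauchy_numer x t : (forall k, t - p k != 0) ->
  (cauchy_numer x).[t] = (\sum_(k < N) x k / (t - p k)) * \prod_(l < N) (t - p l).
Proof.
move=> tp; rewrite horner_sum mulr_suml; apply: eq_bigr => k _.
rewrite hornerZ horner_prod [in RHS](bigD1 k) //= mulrA divfK //.
by congr (_ * _); apply: eq_bigr => l _; rewrite !hornerE.
Qed.

(** The numerator has degree below [N] and vanishes at the [N] distinct points [a j], so it is zero;
    its value at the pole [p k] isolates [x k]. *)
Lemma cauchy_system_inj x :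
  (forall j, \sum_(k < N) x k / (a j - p k) = 0) -> forall k, x k = 0.
Proof.
move=> x0 k.
have P0 : cauchy_numer x = 0.
  apply/eqP/negPn/negP => Pn0.
  have := max_poly_roots Pn0 (rs := codom a).
  rewrite size_codom card_ord ltnNge size_cauchy_numer => H.
  apply/notF/H; last exact/injectiveP.
  apply/allP => _ /codomP[j ->]; apply/rootP.
  by rewrite horner_cauchy_numer // x0 mul0r.
have := horner_cauchy_numer_pole x k; rewrite P0 horner0 => /esym/eqP.
rewrite mulf_eq0 => /orP[/eqP //|/prodf_eq0[l lk]].
by rewrite subr_eq0 (inj_eq p_inj) eq_sym (negbTE lk).
Qed.

(** Both sides are monic of degree [N], and the left one vanishes at every [a j] because
    [1 - \sum_k x k / ('X - p k)] does. *)
Lemma cauchy_system_sol x :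
  (forall j, \sum_(k < N) x k / (a j - p k) = 1) ->
  \prod_(k < N) ('X - (p k)%:P) - cauchy_numer x = \prod_(j < N) ('X - (a j)%:P).
Proof.
move=> x1.
set P := _ - _.
have szp : size (\prod_(k < N) ('X - (p k)%:P)) = N.+1.
  by rewrite size_prod_XsubC -[index_enum _]enumT -cardE card_ord.
have ltN : (size (- cauchy_numer x) < size (\prod_(k < N) ('X - (p k)%:P))%R)%N.
  by rewrite size_polyN szp ltnS size_cauchy_numer.
have szP : size P = N.+1 by rewrite size_polyDl.
have lP : lead_coef P = 1.
  by rewrite lead_coefDl //; apply/eqP; apply: monic_prod_XsubC.
have -> : P = lead_coef P *: \prod_(z <- codom a) ('X - z%:P).
  apply: all_roots_prod_XsubC.
  - by rewrite size_codom card_ord.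
  - apply/allP => _ /codomP[j ->]; apply/rootP.
    rewrite /P hornerD hornerN horner_cauchy_numer // x1 mul1r.
    by rewrite horner_prod_XsubC subrr.
  - by rewrite uniq_rootsE; apply/injectiveP.
by rewrite lP scale1r big_map big_enum.
Qed.

(** At the pole [p k] the product over all poles vanishes, leaving only the residue term. *)
Lemma cauchy_system_coef x :
  (forall j, \sum_(k < N) x k / (a j - p k) = 1) ->
  forall k, x k * \prod_(l < N | l != k) (p k - p l) = - \prod_(j < N) (p k - a j).
Proof.
move=> /cauchy_system_sol E k; rewrite -horner_cauchy_numer_pole.
have := congr1 (fun q => q.[p k]) E.
rewrite hornerD hornerN !horner_prod_XsubC (bigD1 k) //= subrr mul0r sub0r.
by move=> <-; rewrite opprK.
Qed.

(** The same identity read away from the poles; it serves below at [t = - sigma k]. *)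
Lemma cauchy_system_eval x t : (forall k, t - p k != 0) ->
  (forall j, \sum_(k < N) x k / (a j - p k) = 1) ->
  (1 - \sum_(k < N) x k / (t - p k)) * \prod_(l < N) (t - p l)
  = \prod_(j < N) (t - a j).
Proof.
move=> tp /cauchy_system_sol E.
have := congr1 (fun q => q.[t]) E.
by rewrite hornerD hornerN !horner_prod_XsubC horner_cauchy_numer // mulrBl mul1r.
Qed.
End CauchySystems.

(** * Derivability of complex-valued functions of a real variable *)

Section ComponentwiseDerivability.
Variables (R : realType) (x : R).
Implicit Types f g : R -> R[i].

(** Componentwise, to match [derivC]; everything then reduces to real differentiation rules. *)
Definition derivableC f :=
  derivable (fun t => complex.Re (f t)) x 1 /\
  derivable (fun t => complex.Im (f t)) x 1.

Lemma derivableC_cst c : derivableC (fun=> c).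
Proof. by split; apply: derivable_cst. Qed.

Lemma derivableC_add f g :
  derivableC f -> derivableC g -> derivableC (fun t => f t + g t).
Proof.
move=> [fr fi] [gr gi]; split.
  have -> : (fun t => complex.Re (f t + g t)) =
      (fun t => complex.Re (f t)) + (fun t => complex.Re (g t)).
    by apply/funext => t; rewrite fctE; case: (f t) (g t) => [? ?] [].
  exact: (derivableD fr gr).
have -> : (fun t => complex.Im (f t + g t)) =
    (fun t => complex.Im (f t)) + (fun t => complex.Im (g t)).
  by apply/funext => t; rewrite fctE; case: (f t) (g t) => [? ?] [].
exact: (derivableD fi gi).
Qed.

Lemma derivableC_mul f g :
  derivableC f -> derivableC g -> derivableC (fun t => f t * g t).
Proof.
move=> [fr fi] [gr gi]; split.
  have -> : (fun t => complex.Re (f t * g t)) =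
      (fun t => complex.Re (f t)) * (fun t => complex.Re (g t)) -
      (fun t => complex.Im (f t)) * (fun t => complex.Im (g t)).
    by apply/funext => t; rewrite !fctE; case: (f t) (g t) => [? ?] [].
  exact: (derivableB (derivableM fr gr) (derivableM fi gi)).
have -> : (fun t => complex.Im (f t * g t)) =
    (fun t => complex.Re (f t)) * (fun t => complex.Im (g t)) +
    (fun t => complex.Im (f t)) * (fun t => complex.Re (g t)).
  by apply/funext => t; rewrite !fctE; case: (f t) (g t) => [? ?] [].
exact: (derivableD (derivableM fr gi) (derivableM fi gr)).
Qed.

Lemma derivableC_inv f :
  f x != 0 -> derivableC f -> derivableC (fun t => (f t)^-1).
Proof.
move=> fx0 [fr fi].
(* [n2] is the squared modulus of [f], and the inverse of [f] is its conjugate divided by [n2]. *)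
pose n2 := (fun t => complex.Re (f t)) * (fun t => complex.Re (f t)) +
  (fun t => complex.Im (f t)) * (fun t => complex.Im (f t)).
have dn2 : derivable (fun t => (n2 t)^-1) x 1.
  apply: derivableV; last exact: (derivableD (derivableM fr fr) (derivableM fi fi)).
  move: fx0; rewrite /n2 !fctE; case: (f x) => a b /=.
  by rewrite -!expr2 paddr_eq0 ?sqr_ge0 // !sqrf_eq0 eq_complex.
split.
  have -> : (fun t => complex.Re (f t)^-1) =
      (fun t => complex.Re (f t)) * (fun t => (n2 t)^-1).
    by apply/funext => t; rewrite /n2 !fctE -!expr2; case: (f t).
  exact: (derivableM fr dn2).
have -> : (fun t => complex.Im (f t)^-1) =
    - ((fun t => complex.Im (f t)) * (fun t => (n2 t)^-1)).
  by apply/funext => t; rewrite /n2 !fctE -!expr2; case: (f t).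
exact: (derivableN (derivableM fi dn2)).
Qed.

Lemma derivableC_sum (I : Type) (r : seq I) (P : pred I) (F : I -> R -> R[i]) :
  (forall i, derivableC (F i)) -> derivableC (fun t => \sum_(i <- r | P i) F i t).
Proof.
move=> dF; elim: r => [|i r IH].
  by under eq_fun do rewrite big_nil; apply: derivableC_cst.
under eq_fun do rewrite big_cons.
by case: (P i); first exact: (derivableC_add (dF i) IH).
Qed.

Lemma derivableC_prod (I : Type) (r : seq I) (P : pred I) (F : I -> R -> R[i]) :
  (forall i, derivableC (F i)) -> derivableC (fun t => \prod_(i <- r | P i) F i t).
Proof.
move=> dF; elim: r => [|i r IH].
  by under eq_fun do rewrite big_nil; apply: derivableC_cst.
under eq_fun do rewrite big_cons.
by case: (P i); first exact: (derivableC_mul (dF i) IH).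
Qed.

(** By the Leibniz expansion, a determinant is a sum of signed products of entries. *)
Lemma derivableC_det n (M : R -> 'M[R[i]]_n) :
  (forall i j, derivableC (fun t => M t i j)) -> derivableC (fun t => \det (M t)).
Proof.
move=> dM; apply: derivableC_sum => s.
apply: derivableC_mul; first exact: derivableC_cst.
exact: derivableC_prod.
Qed.

Lemma derivableC_adj n (M : R -> 'M[R[i]]_n) i j :
  (forall i j, derivableC (fun t => M t i j)) ->
  derivableC (fun t => (\adj (M t)) i j).
Proof.
move=> dM; under eq_fun do rewrite mxE.
apply: derivableC_mul; first exact: derivableC_cst.
by apply: derivableC_det => k l; under eq_fun do rewrite !mxE.
Qed.

Lemma derivableC_mulmx m n q (A : R -> 'M[R[i]]_(m, n)) (B : R -> 'M[R[i]]_(n, q)) :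
  (forall i j, derivableC (fun t => A t i j)) ->
  (forall i j, derivableC (fun t => B t i j)) ->
  forall i j, derivableC (fun t => (A t *m B t) i j).
Proof.
move=> dA dB i j; under eq_fun do rewrite mxE.
by apply: derivableC_sum => k; apply: derivableC_mul.
Qed.

Lemma derivableC_expi : derivableC (@expi R).
Proof. by split; [exact: derivable_cos | exact: derivable_sin]. Qed.

(** One of the two real components is nonzero at [x], and by continuity it stays so nearby. *)
Lemma derivableC_near_neq0 f :
  derivableC f -> f x != 0 -> \forall t \near x, f t != 0.
Proof.
move=> [fr fi] fx0.
have near_neq0r (h : R -> R) :
    derivable h x 1 -> h x != 0 -> \forall t \near x, h t != 0.
  move=> /derivable1_diffP/differentiable_continuous hc hx0.
  exact: (@cvgr_neq0 _ _ _ _ _ _ (h x) hc hx0).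
have [re0|re0] := eqVneq (complex.Re (f x)) 0.
  have im0 : complex.Im (f x) != 0.
    by move: fx0; rewrite eq_complex re0 eqxx.
  by apply: filterS (near_neq0r _ fi im0) => t; apply: contraNneq => ->.
by apply: filterS (near_neq0r _ fr re0) => t; apply: contraNneq => ->.
Qed.
End ComponentwiseDerivability.

(** * The derivative of the resolvent pairing at z = 1 *)

Local Notation "A ^C" := (map_mx (real_complex _) A) : ring_scope.

Lemma hdot_ones (R : realType) N (v : 'cV[R[i]]_N) :
  hdot v (ones R N) = ((const_mx 1 : 'rV_N) *m v) 0 0.
Proof.
by rewrite /hdot mxE; apply: eq_bigr => k _; rewrite !mxE rmorph1 mulr1 mul1r.
Qed.

(** The bracket is the imaginary part of [(expi t - 1) * (k + i h)]. At 0, [cos - 1], its derivative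
    and [sin] all vanish, so only [cos 0 * k 0] survives. *)
Lemma is_derive_rotation_mul (R : realType) (c : R) (h k : R -> R) :
  derivable h 0 1 -> derivable k 0 1 ->
  is_derive (0 : R) 1 (cst c + ((@cos R - cst 1) * h + @sin R * k)) (k 0).
Proof.
move=> /derivableP dh /derivableP dk.
have dc := is_deriveM
  (is_deriveB (is_derive_cos (0 : R)) (is_derive_cst (1 : R) (0 : R) (1 : R))) dh.
have ds := is_deriveM (is_derive_sin (0 : R)) dk.
apply: is_derive_eq (is_deriveD (is_derive_cst c (0 : R) (1 : R)) (is_deriveD dc ds)) _.
rewrite !fctE cos0 sin0 subrr oppr0 addr0 !scaler0 !scale0r !add0r.
by rewrite /GRing.scale /= mulr1.
Qed.

Lemma Im_add_subr1_mul (R : realType) (a b z : R[i]) :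
  complex.Im (a + (z - 1) * b) = complex.Im a +
    ((complex.Re z - 1) * complex.Im b + complex.Im z * complex.Re b).
Proof. by case: a b z => [? ?] [? ?] [? ?] /=; rewrite subr0. Qed.

Section Resolvent.
Variables (R : realType) (N : nat) (K B : 'M[R]_N).
Hypothesis K_unit : K \in unitmx.

Let M (z : R[i]) : 'M[R[i]]_N := K^C - (z - 1) *: B^C.

(** The resolvent identity [M^-1 - K^-1 = M^-1 (K - M) K^-1]. The explicit factor [z - 1] means that
    only the value of the remaining factor at [z = 1] enters the derivative there. *)
Lemma resolvent_expansion z : M z \in unitmx ->
  invmx (M z) = invmx K^C + (z - 1) *: (invmx (M z) *m B^C *m invmx K^C).
Proof.
move=> Mu; have Ku : K^C \in unitmx by rewrite map_unitmx.
rewrite scalemxAl scalemxAr.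
have -> : (z - 1) *: B^C = K^C - M z by rewrite /M subKr.
by rewrite mulmxBr mulmxBl mulVmx // mul1mx mulmxK // addrC subrK.
Qed.

(* [Re (u (expi t))] has derivative 0 at [t = 0], so [Im] carries all of [u'(1)]. *)
Lemma is_derive_Im_resolvent :
  is_derive (0 : R) 1
    (fun t => complex.Im (hdot (invmx (M (expi t)) *m ones R N) (ones R N)))
    (((const_mx 1 : 'rV[R]_N) *m (invmx K *m B *m invmx K) *m (const_mx 1 : 'cV_N)) 0 0).
Proof.
set D := _ 0 0.
pose w : 'cV[R[i]]_N := B^C *m invmx K^C *m ones R N.
(* Adjugate over determinant replaces [invmx], which is defined by cases on invertibility;
   derivability then follows entrywise. *)
pose g t := (\det (M (expi t)))^-1 *
  ((const_mx 1 : 'rV_N) *m (\adj (M (expi t)) *m w)) 0 0.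
have e0 : expi (0 : R) = 1 by rewrite /expi cos0 sin0.
have M0 : M (expi 0) = K^C by rewrite /M e0 subrr scale0r subr0.
have det0 : \det (M (expi 0)) != 0.
  by rewrite M0 -unitfE -unitmxE map_unitmx.
have gE t : M (expi t) \in unitmx ->
    g t = ((const_mx 1 : 'rV_N) *m (invmx (M (expi t)) *m w)) 0 0.
  by move=> Mu; rewrite /g /invmx Mu -scalemxAl -scalemxAr [in RHS]mxE.
have g0 : g 0 = D%:C%C.
  rewrite gE ?M0 ?map_unitmx // /w /D /ones.
  have -> : (const_mx 1 : 'rV[R[i]]_N) = (const_mx 1 : 'rV[R]_N)^C.
    by rewrite map_const_mx rmorph1.
  have -> : (const_mx 1 : 'cV[R[i]]_N) = (const_mx 1 : 'cV[R]_N)^C.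
    by rewrite map_const_mx rmorph1.
  by rewrite -map_invmx -!map_mxM mxE !mulmxA.
have dM i j : derivableC 0 (fun t => M (expi t) i j).
  under eq_fun do rewrite 4!mxE mulrBl opprB addrA addrC.
  apply: derivableC_add; last exact: derivableC_cst.
  under eq_fun do rewrite -mulrN.
  by apply: derivableC_mul; [exact: derivableC_expi | exact: derivableC_cst].
have ddet : derivableC 0 (fun t => \det (M (expi t))) by apply: derivableC_det.
have [gr gi] : derivableC 0 g.
  apply: derivableC_mul; first exact: derivableC_inv.
  apply: derivableC_mulmx => i j; first exact: derivableC_cst.
  apply: derivableC_mulmx => k l; last exact: derivableC_cst.
  exact: derivableC_adj.
pose c := complex.Im (hdot (invmx K^C *m ones R N) (ones R N)).
have : is_derive (0 : R) 1 (cst c + ((@cos R - cst 1) * (fun t => complex.Im (g t)) +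
    @sin R * (fun t => complex.Re (g t)))) D.
  suff <- : complex.Re (g 0) = D by exact: (is_derive_rotation_mul c gi gr).
  by rewrite g0.
(* The expansion holds where [M (expi t)] is invertible, which is a neighbourhood of 0. *)
apply: near_eq_is_derive.
near=> t.
have Mu : M (expi t) \in unitmx.
  by rewrite unitmxE unitfE; near: t; apply: derivableC_near_neq0.
rewrite [in RHS](resolvent_expansion Mu) mulmxDl !hdot_ones mulmxDr.
rewrite -scalemxAl -scalemxAr -!mulmxA /c hdot_ones !fctE (gE _ Mu) /w -mulmxA.
set Q := const_mx 1 *m (invmx K^C *m _); set S := const_mx 1 *m _.
rewrite [(Q + _) 0 0]mxE [(_ *: S) 0 0]mxE.
by rewrite [RHS]Im_add_subr1_mul.
Unshelve. all: by end_near.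
Qed.
End Resolvent.

(** The modulus dominates the imaginary part, whatever the real component of [derivC] is. *)
Lemma derive_Im_le_C1norm (R : realType) (f : R[i] -> R[i]) (x d : R) :
  is_derive x 1 (fun t => complex.Im (f (expi t))) d -> (d%:E <= C1norm f)%E.
Proof.
move=> df.
apply: le_trans (ereal_sup_ubound _); last by exists x.
have -> : derivC (fun t => f (expi t)) x =
    Complex (derive1 (fun t => complex.Re (f (expi t))) x) d.
  by rewrite /derivC [X in Complex _ X]derive1E derive_val.
rewrite lee_fin /=; apply: le_trans (ler_norm d) _.
by rewrite -sqrtr_sqr ler_wsqrtr // lerDr sqr_ge0.
Qed.

(** * Interlacing, and the closed form of u'(1) *)

Section Interlacing.
Variables (R : realType) (N : nat) (rho sigma : 'I_N -> R).
Hypothesis rho_gt_sigma : forall j : 'I_N, sigma j < rho j.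
Hypothesis sigma_gt_rho : forall j k : 'I_N, nat_of_ord k = (nat_of_ord j).+1 ->
  rho k < sigma j.
Hypothesis sigma_gt0 : forall j : 'I_N, 0 < sigma j.

Let rho_gt0 j : 0 < rho j := lt_trans (sigma_gt0 j) (rho_gt_sigma j).

(** Induction on [k], chaining [rho (k+1) < sigma k < rho k] down to index [j]. *)
Lemma rho_lt_sigma (j k : 'I_N) : (j < k)%N -> rho k < sigma j.
Proof.
case: k => k kN /=; elim: k kN => [|k IH] kN //; rewrite ltnS leq_eqVlt.
case/orP => [/eqP jk|jk]; first by apply: sigma_gt_rho; rewrite /= jk.
have kN' := ltnW kN; apply: lt_trans (IH kN' jk).
exact: lt_trans (@sigma_gt_rho (Ordinal kN') (Ordinal kN) erefl) (rho_gt_sigma _).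
Qed.

Lemma sigma_inj : injective sigma.
Proof.
move=> j k jk; apply/val_inj.
case: (ltngtP j k) => // /rho_lt_sigma h.
  by have := lt_trans (rho_gt_sigma _) h; rewrite jk ltxx.
by have := lt_trans (rho_gt_sigma _) h; rewrite jk ltxx.
Qed.

Lemma rho_inj : injective rho.
Proof.
move=> j k jk; apply/val_inj.
case: (ltngtP j k) => // /rho_lt_sigma h.
  by have := lt_trans h (rho_gt_sigma _); rewrite jk ltxx.
by have := lt_trans h (rho_gt_sigma _); rewrite jk ltxx.
Qed.

Lemma rho_neq_sigma j k : rho j != sigma k.
Proof.
case: (ltngtP k j) => [/rho_lt_sigma/lt_eqF -> //|jk|/val_inj ->]; rewrite gt_eqF //.
exact: lt_trans (lt_trans (rho_gt_sigma k) (rho_lt_sigma jk)) (rho_gt_sigma j).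
Qed.

(** [cauchy_mx] is K, the value of [CN] at 1; [slope_mx] is B, minus the coefficient of [z] in
    [CN]. *)
Definition cauchy_mx : 'M[R]_N := \matrix_(j, k) (rho j + sigma k)^-1.
Definition slope_mx : 'M[R]_N := \matrix_(j, k) (sigma k / (rho j ^+ 2 - sigma k ^+ 2)).

(** The double minus fits the pattern [a j - p k]: nodes [rho] with poles [- sigma] here, nodes
    [sigma] with poles [- rho] in the next fact. *)
Let rs_neq0 j k : rho j - - sigma k != 0.
Proof. by rewrite opprK gt_eqF // addr_gt0. Qed.

Let sr_neq0 j k : sigma j - - rho k != 0.
Proof. by rewrite opprK gt_eqF // addr_gt0. Qed.

Let sq_neq0 j k : rho j ^+ 2 - sigma k ^+ 2 != 0.
Proof.
rewrite subr_sqr mulf_neq0 // ?subr_eq0 ?rho_neq_sigma //.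
by rewrite gt_eqF // addr_gt0.
Qed.

(** A row in the kernel of the transpose solves the homogeneous Cauchy system, hence is zero. *)
Lemma cauchy_mx_unit : cauchy_mx \in unitmx.
Proof.
rewrite -unitmx_tr -row_free_unit -kermx_eq0; apply/rowV0P => v /sub_kermxP vK.
apply/rowP => k; rewrite [RHS]mxE.
apply: (@cauchy_system_inj _ _ rho (fun k => - sigma k) _ _ rs_neq0 (v 0)).
- exact: rho_inj.
- by move=> i j /oppr_inj/sigma_inj.
move=> j; have := congr1 (fun m : 'rV_N => m 0 j) vK; rewrite !mxE.
by apply: etrans; apply: eq_bigr => i _; rewrite !mxE opprK.
Qed.

(** Entrywise, [rho - sigma z = (rho - sigma) - (z - 1) sigma], and [rho - sigma] cancels against
    [rho^2 - sigma^2]. *)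
Lemma CN_resolvent z :
  CN rho sigma z = map_mx (real_complex _) cauchy_mx -
    (z - 1) *: map_mx (real_complex _) slope_mx.
Proof.
apply/matrixP => j k; rewrite !mxE.
have -> : (rho j + sigma k)^-1 = (rho j - sigma k) / (rho j ^+ 2 - sigma k ^+ 2).
  rewrite subr_sqr invfM mulrA divff ?mul1r //.
  by rewrite subr_eq0 rho_neq_sigma.
rewrite !rmorphM /= fmorphV /= rmorphB /=; ring.
Qed.

(** With [K x = 1] and [y K = 1^T], u'(1) becomes the sum over [k] of [(y B)_k x_k]. *)
Let x : 'cV[R]_N := invmx cauchy_mx *m const_mx 1.
Let y : 'rV[R]_N := const_mx 1 *m invmx cauchy_mx.

Let x_eq j : \sum_k x k 0 / (rho j - - sigma k) = 1.
Proof.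
have : (cauchy_mx *m x) j 0 = 1 by rewrite mulKVmx ?cauchy_mx_unit // mxE.
rewrite mxE => <-; apply: eq_bigr => k _.
by rewrite [cauchy_mx _ _]mxE opprK mulrC.
Qed.

Let y_eq k : \sum_j y 0 j / (sigma k - - rho j) = 1.
Proof.
have : (y *m cauchy_mx) 0 k = 1 by rewrite mulmxKV ?cauchy_mx_unit // mxE.
rewrite mxE => <-; apply: eq_bigr => j _.
by rewrite [cauchy_mx _ _]mxE opprK [sigma k + _]addrC.
Qed.

Let gain (k l : 'I_N) := (sigma k + sigma l) * (sigma k + rho l) /
  ((rho l - sigma k) * (sigma l - sigma k)).

(** Since [sigma k] does not lie between [sigma l] and [rho l], the denominator is positive;
    numerator minus denominator is [2 sigma_k (sigma_l + rho_l)]. *)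
Let gain_ge1 k l : l != k -> 1 <= gain k l.
Proof.
move=> lk; have den_gt0 : 0 < (rho l - sigma k) * (sigma l - sigma k).
  case: (ltngtP l k) => [h|h|/val_inj e]; last by rewrite e eqxx in lk.
    have := rho_lt_sigma h; have := rho_gt_sigma k; have := rho_gt_sigma l.
    by move=> ? ? ?; apply: mulr_gt0; rewrite subr_gt0; lra.
  have := rho_lt_sigma h; have := rho_gt_sigma l.
  by move=> ? ?; rewrite nmulr_lgt0 subr_lt0; lra.
rewrite /gain ler_pdivlMr // mul1r -subr_ge0.
have -> : (sigma k + sigma l) * (sigma k + rho l) -
    (rho l - sigma k) * (sigma l - sigma k) = 2 * (sigma k * (sigma l + rho l)).
  by ring.
by rewrite !mulr_ge0 // ?addr_ge0 // ltW.
Qed.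

(** Partial fractions: [2 sigma / (rho^2 - sigma^2) = 1 / (rho - sigma) - 1 / (rho + sigma)]; the
    second part sums to 1 by [y_eq]. *)
Let yB k : (y *m slope_mx) 0 k =
  2^-1 * (\sum_j y 0 j / (- sigma k - - rho j) - 1).
Proof.
rewrite -[X in _ - X](y_eq k) -sumrB mulr_sumr [LHS]mxE; apply: eq_bigr => j _.
rewrite [slope_mx _ _]mxE.
have := sq_neq0 j k; rewrite subr_sqr mulf_eq0 negb_or => /andP[h1 h2].
field.
by rewrite !opprK [- _ + _]addrC [sigma k + _]addrC h1 h2.
Qed.

(** [x k] is a coefficient of the first Cauchy system; [(y B)_k] is the second system evaluated at
    [- sigma k], which is not one of its poles. *)
Let summandE k : (y *m slope_mx) 0 k * x k 0 =
  sigma k * (rho k + sigma k) / (rho k - sigma k) * \prod_(l < N | l != k) gain k l.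
Proof.
have Hx := cauchy_system_coef rho_inj rs_neq0 x_eq k.
have mrs_neq0 l : - sigma k - - rho l != 0.
  by rewrite opprK addrC subr_eq0 rho_neq_sigma.
have := cauchy_system_eval sigma_inj sr_neq0 mrs_neq0 y_eq.
rewrite yB; set S := \sum_j _ => Hy.
pose p := \prod_(l < N | l != k) (- sigma k - - sigma l).
have p_neq0 : p != 0.
  by apply/prodf_neq0 => l lk; rewrite opprK addrC subr_eq0 (inj_eq sigma_inj).
pose q := \prod_(l < N) (- sigma k - - rho l).
have q_neq0 : q != 0 by apply/prodf_neq0.
have -> : x k 0 = - (\prod_j (- sigma k - rho j)) / p by rewrite -Hx mulfK.
have -> : S - 1 = - (\prod_j (- sigma k - sigma j)) / q.
  by rewrite -Hy -mulNr mulfK // opprB.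
rewrite mulrA.
have -> : 2^-1 * (- (\prod_j (- sigma k - sigma j)) / q) *
    - (\prod_j (- sigma k - rho j)) / p =
  2^-1 * (\prod_j ((sigma k + sigma j) * (sigma k + rho j)) / (q * p)).
  rewrite big_split /=.
  have e (f : 'I_N -> R) : \prod_j (- sigma k - f j) =
      (-1) ^+ N * \prod_j (sigma k + f j).
    under eq_bigr do rewrite -opprD -mulN1r.
    by rewrite big_split /= prodr_const card_ord.
  (* Each numerator product yields a sign [(-1)^N], and the two signs multiply to 1. *)
  rewrite !e; have := sqrr_sign R N; set s := (-1) ^+ N => s1.
  by field: s1; rewrite p_neq0 q_neq0.
have -> : q * p = (rho k - sigma k) *
    \prod_(l < N | l != k) ((rho l - sigma k) * (sigma l - sigma k)).
  rewrite /q (bigD1 k) //= big_split /= -mulrA opprK [- _ + _]addrC.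
  by congr (_ * (_ * _)); apply: eq_bigr => l _; rewrite opprK addrC.
(* The factor [l = k] of the numerator is [2 sigma_k (sigma_k + rho_k)], whose 2 cancels [2^-1]. *)
rewrite (bigD1 k) //= /gain prodf_div.
have : \prod_(l < N | l != k) ((rho l - sigma k) * (sigma l - sigma k)) != 0.
  apply/prodf_neq0 => l lk.
  by rewrite mulf_neq0 // subr_eq0 ?rho_neq_sigma // (inj_eq sigma_inj).
set P1 := \prod_(l < N | l != k) _; set P2 := \prod_(l < N | l != k) _ => P_neq0.
have rk : rho k - sigma k != 0 by rewrite subr_eq0 rho_neq_sigma.
by field; rewrite P_neq0 rk.
Qed.

Lemma slope_lower_bound :
  \sum_(k < N) sigma k * (rho k + sigma k) / (rho k - sigma k) <=
  ((const_mx 1 : 'rV[R]_N) *m (invmx cauchy_mx *m slope_mx *m invmx cauchy_mx) *m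
    (const_mx 1 : 'cV_N)) 0 0.
Proof.
rewrite !mulmxA -/y -mulmxA -/x [leRHS]mxE; apply: ler_sum => k _.
rewrite summandE ler_peMr //.
  apply: ltW; apply: divr_gt0; last by rewrite subr_gt0.
  by apply: mulr_gt0 => //; apply: addr_gt0.
apply: (big_ind (fun r => 1 <= r)) => // [r s r1 s1|l]; last exact: gain_ge1.
by rewrite (le_trans r1) // ler_peMr // (le_trans ler01).
Qed.

End Interlacing.

Theorem corollary3 (R : realType) (N : nat) (rho sigma : 'I_N -> R)
  (N_ge1 : (1 <= N)%N)
  (rho_gt_sigma : forall j : 'I_N, sigma j < rho j)
  (sigma_gt_rho : forall j k : 'I_N, nat_of_ord k = (nat_of_ord j).+1 ->
     rho k < sigma j)
  (sigma_gt0 : forall j : 'I_N, 0 < sigma j) :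
  ((\sum_(k < N) sigma k * (rho k + sigma k) / (rho k - sigma k))%:E
     <= C1norm (u_sym rho sigma))%E.
Proof.
(* The supremum is tested at [x = 0], that is at [z = 1]. *)
apply: (@le_trans _ _ _ _ _ _ (derive_Im_le_C1norm (x := 0) _)).
  by rewrite lee_fin; apply: slope_lower_bound.
have := is_derive_Im_resolvent (slope_mx rho sigma)
  (cauchy_mx_unit rho_gt_sigma sigma_gt_rho sigma_gt0).
congr is_derive; apply/funext => t.
by rewrite /u_sym CN_resolvent.
Qed.
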